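(* Let $K \subset \mathbb{R}^n$ be a convex body with $s(K) \geq n-\varepsilon$ for some $\varepsilon \in (0,1)$. Then $$d_{BM}(K,\mathcal{S}^n) \leq 1 + \varepsilon + \frac{\varepsilon^2}{2(1-\varepsilon)} = 1 + \varepsilon + \sum_{k=2}^\infty \frac{\varepsilon^k}{2}.$$ Further, for all $n \geq 2$ and $\varepsilon \in [0,1]$, there exists a convex body $K \subset \mathbb{R}^n$ with $s(K) = n-\varepsilon$ and $d_{BM}(K,\mathcal{S}^n) = 1+\varepsilon$.
   Context: A convex body in $\mathbb{R}^n$ is a compact convex set with non-empty interior. The Minkowski asymmetry of a convex body $K$ is $s(K) = \inf\{\rho \geq 0 : K - c \subset \rho(c-K) \text{ for some } c \in \mathbb{R}^n\}$. $\mathcal{S}^n$ denotes any $n$-dimensional simplex (convex hull of $n+1$ affinely independent points in $\mathbb{R}^n$). The Banach--Mazur distance between convex bodies $K, L \subset \mathbb{R}^n$ is $d_{BM}(K,L) = \inf\{\rho \geq 0 : u + K \subset AL \subset v + \rho K \text{ for some invertible } A \in \mathbb{R}^{n\times n} \text{ and } u,v \in \mathbb{R}^n\}$; since it is invariant under invertible affine maps, $d_{BM}(K,\mathcal{S}^n)$ does not depend on the choice of simplex. *)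

(* Defs.v *)
From mathcomp Require Import all_boot all_order all_algebra.
From mathcomp Require Import all_classical all_reals all_analysis.

Set Implicit Arguments.
Unset Strict Implicit.
Unset Printing Implicit Defensive.

Import Order.TTheory GRing.Theory Num.Theory.
Import numFieldNormedType.Exports.

Local Open Scope classical_set_scope.
Local Open Scope ring_scope.

(* R^n is 'cV[R]_n; its topology (induced by the sup norm) is the usual one. *)

Definition convex_body (R : realType) (n : nat) (K : set 'cV[R]_n) : Prop :=
  [/\ compact K, convex_set K & K° !=set0].

Definition minkowski_asymmetry (R : realType) (n : nat) (K : set 'cV[R]_n) : R :=
  inf [set rho : R | 0 <= rho /\ exists c : 'cV[R]_n,
    [set x - c | x in K] `<=` [set rho *: (c - x) | x in K]].

Definition affinely_independent (R : realType) (n m : nat)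
    (p : 'I_m -> 'cV[R]_n) : Prop :=
  forall a : 'I_m -> R, \sum_(i < m) a i = 0 -> \sum_(i < m) a i *: p i = 0 ->
    forall i, a i = 0.

Definition convex_hull (R : realType) (n : nat) (A : set 'cV[R]_n) :
  set 'cV[R]_n := smallest (@convex_set R 'cV[R]_n) A.

Definition simplex (R : realType) (n : nat) (S : set 'cV[R]_n) : Prop :=
  exists2 p : 'I_n.+1 -> 'cV[R]_n,
    affinely_independent p & S = convex_hull (range p).

Definition banach_mazur (R : realType) (n : nat) (K L : set 'cV[R]_n) : R :=
  inf [set rho : R | 0 <= rho /\
    exists (A : 'M[R]_n) (u v : 'cV[R]_n),
      [/\ A \in unitmx,
          [set u + x | x in K] `<=` [set A *m y | y in L] &
          [set A *m y | y in L] `<=` [set v + rho *: x | x in K]]].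

(* Main.v *)
Require Import Defs.
From mathcomp Require Import all_boot all_order all_algebra.
From mathcomp Require Import all_classical all_reals all_analysis.
From mathcomp Require Import ring lra.

Set Implicit Arguments.
Unset Strict Implicit.
Unset Printing Implicit Defensive.

Import Order.TTheory GRing.Theory Num.Theory.
Import numFieldNormedType.Exports.
Local Open Scope classical_set_scope.
Local Open Scope ring_scope.

(** Upper bound.  By convex duality, asymmetry larger than [rho] means that
    there are [n + 1] affine functions [f_i], nonnegative on [K] and of sum 1,
    whose maxima over [K] add up to more than [1 + rho] ([certificate_size]).
    Indeed [K - c] lies in [rho (c - K)] for no [c] exactly when the translates
    [x + rho K], for [x] in [K], have no common point ([rho > 0]).  By compactness finitely
    many of them already have none, these are separated by functionals of sum 0,
    and a Caratheodory argument brings the number of functionals down to [n + 1].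

    Let [p_i] in [K] maximise [f_i].  The matrix [mu i j = f_j (p_i)] is
    stochastic, and when [rho = n - eps] its diagonal falls short of the
    identity by a total of at most [eps].  The simplex [P] with vertices [p_i]
    lies in [K].  If every [x] in [K] has [i]-th barycentric coordinate at least
    [- m_i] with respect to [P], then [K] lies in a translate of
    [(1 + sum m_i) P], so [1 + sum m_i] bounds the distance from [K] to a simplex
    ([inscribed_simplex_ratio]).  On [K] one has [0 <= f_j <= mu j j]; expressed
    in barycentric coordinates, these inequalities bound the least coordinates
    [- m_i] and the greatest coordinates [u_i] in terms of each other.  Adding
    them up with weights proportional to the defects [1 - mu i i]
    ([stochastic_weights], [stochastic_sum_bound]) gives the stated bound.

    Sharpness.  Take the simplex with vertices [0], [e_1], ..., [e_(n-1)], and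
    join it to its [eps]-homothetic copy lying at height 1 in the direction
    [e_0].  For this frustum the asymmetry is read off from the facets.  The
    distance is at most [1 + eps] because of the inscribed simplex that consists
    of the base and one vertex of the top.  It is at least [1 + eps] because of
    the trapezoid [0], [e_1], [e_0], [e_0 + eps e_1] alone: its width and its
    height are both at most 1 in [K], and comparing them with the barycentric
    coordinates of its four corners in the surrounding simplex forces the ratio
    up ([banach_mazur_frustum_ge]). *)

(** * Simplices and barycentric coordinates *)

Lemma convex_setP (R : realType) (n : nat) (K : set 'cV[R]_n) :
  convex_set K <-> forall x y (t : R), K x -> K y -> 0 <= t <= 1 ->
    K (t *: x + (1 - t) *: y).
Proof.
split=> [cK x y t Kx Ky t01 | cK x y t].
  by have := cK x y (Itv01 (andP t01).1 (andP t01).2); rewrite !inE => /(_ Kx Ky).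
by rewrite !inE => Kx Ky; apply: cK => //; rewrite ge0 le1.
Qed.

(** The induction runs over unnormalised sums: a partial sum of weights may
    vanish, so no division is made until a weight is known to be nonzero. *)
Lemma convex_set_sum (R : realType) (n : nat) (K : set 'cV[R]_n) (I : finType)
    (c : I -> R) (p : I -> 'cV[R]_n) :
  convex_set K -> (forall i, 0 <= c i) -> \sum_i c i = 1 -> (forall i, K (p i)) ->
  K (\sum_i c i *: p i).
Proof.
move=> /convex_setP cK c0 c1 Kp.
suff H s : s != [::] -> exists2 x, K x & 
    \sum_(i <- s) c i *: p i = (\sum_(i <- s) c i) *: x.
  have [|x Kx] := H (index_enum I); last by rewrite c1 scale1r => ->.
  apply/eqP => s0; move: c1; rewrite s0 big_nil => /eqP.
  by rewrite eq_sym oner_eq0.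
elim: s => // i [|j s] IH _.
  by exists (p i) => //; rewrite !big_seq1.
have [//|x Kx] := IH; rewrite 2!(big_cons _ _ i) => ->.
set w := \sum_(k <- _) c k; have w0 : 0 <= w by apply: sumr_ge0.
have [cw0|cw0] := eqVneq (c i + w) 0.
  have [ci0 ww0] : c i = 0 /\ w = 0 by have ci0 := c0 i; split; lra.
  by exists x; rewrite // ci0 ww0 addr0 !scale0r addr0.
exists ((c i / (c i + w)) *: p i + (1 - c i / (c i + w)) *: x).
  apply: cK => //; have := c0 i => ci0.
  by rewrite divr_ge0 ?addr_ge0//= ler_pdivrMr ?mul1r ?lerDl// lt_def cw0 addr_ge0.
rewrite scalerDr !scalerA; congr (_ *: _ + _ *: _); field => //.
Qed.

Lemma convex_hull_range (R : realType) (n m : nat) (p : 'I_m -> 'cV[R]_n) :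
  convex_hull (range p) = [set x | exists c : 'I_m -> R,
    [/\ forall i, 0 <= c i, \sum_i c i = 1 & x = \sum_i c i *: p i]].
Proof.
apply/seteqP; split => [x|_ [c [c0 c1 ->]] L [cL pL]]; last first.
  by apply: convex_set_sum => // i; apply: pL; exists i.
apply; split=> [|_ [i _ <-]].
  apply/convex_setP => _ _ t [c [c0 c1 ->]] [d [d0 d1 ->]] /andP[t0 t1].
  exists (fun i => t * c i + (1 - t) * d i); split.
  - by move=> i; rewrite addr_ge0 ?mulr_ge0// subr_ge0.
  - by rewrite big_split/= -!mulr_sumr c1 d1; ring.
  - rewrite !scaler_sumr -big_split/=; apply: eq_bigr => i _.
    by rewrite [RHS]scalerDl !scalerA.
exists (fun j => (j == i)%:R); split.
- by move=> j; rewrite ler0n.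
- by rewrite (bigD1 i)//= eqxx big1 ?addr0// => j /negbTE ->.
- rewrite (bigD1 i)//= eqxx scale1r big1 ?addr0// => j /negbTE ->.
  by rewrite scale0r.
Qed.

Lemma mulmx_inj_unit (F : fieldType) (n : nat) (A : 'M[F]_n) :
  (forall x : 'cV_n, A *m x = 0 -> x = 0) -> A \in unitmx.
Proof.
move=> injA; rewrite -unitmx_tr -row_free_unit; apply: inj_row_free => v vA.
have /injA/(congr1 trmx) : A *m v^T = 0 by rewrite -[A]trmxK -trmx_mul vA trmx0.
by rewrite trmxK trmx0.
Qed.

(** Homogeneous coordinates: they make affine functions and affine combinations
    linear, so that both can be handled by matrix products. *)
Definition homog (R : realType) (n : nat) (x : 'cV[R]_n) : 'cV[R]_(1 + n) :=
  col_mx 1%:M x.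

Definition homog_mx (R : realType) (n m : nat) (p : 'I_m -> 'cV[R]_n) :
    'M[R]_(1 + n, m) :=
  \matrix_(i, j) homog (p j) i 0.

Lemma homog_mxM (R : realType) (n m : nat) (p : 'I_m -> 'cV[R]_n) (y : 'cV[R]_m) :
  homog_mx p *m y = col_mx (\sum_i y i 0)%:M (\sum_i y i 0 *: p i).
Proof.
apply/colP => i; rewrite mxE.
rewrite -[i]splitK; case: (fintype.split i) => k /=.
  rewrite col_mxEu !mxE ord1 mulr1n; apply: eq_bigr => j _.
  by rewrite mxE col_mxEu mxE mul1r.
rewrite col_mxEd summxE; apply: eq_bigr => j _.
by rewrite mxE col_mxEd [RHS]mxE mulrC.
Qed.

Lemma homog_mxP (R : realType) (n m : nat) (p : 'I_m -> 'cV[R]_n) (y : 'cV[R]_m)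
    (a : R) (z : 'cV[R]_n) :
  homog_mx p *m y = col_mx a%:M z <->
  \sum_i y i 0 = a /\ \sum_i y i 0 *: p i = z.
Proof.
rewrite homog_mxM; split=> [/eq_col_mx[/matrixP/(_ 0 0)]|[-> ->]//].
by rewrite !mxE !mulr1n.
Qed.

Lemma homog_mx_unit (R : realType) (n : nat) (p : 'I_n.+1 -> 'cV[R]_n) :
  affinely_independent p <-> (homog_mx p : 'M[R]_n.+1) \in unitmx.
Proof.
have col00 : col_mx (0%:M : 'M[R]_1) (0 : 'cV_n) = 0 by rewrite raddf0 col_mx0.
split=> [ip | up a a0 ap].
  apply: mulmx_inj_unit => y y0.
  have [s0 sp0] : \sum_i y i 0 = 0 /\ \sum_i y i 0 *: p i = 0.
    by apply/homog_mxP; rewrite col00.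
  by apply/colP => i; rewrite (ip _ s0 sp0) mxE.
pose y : 'cV[R]_n.+1 := \col_i a i.
have : homog_mx p *m y = col_mx 0%:M 0.
  apply/homog_mxP; split; [rewrite -[RHS]a0|rewrite -[RHS]ap];
  by apply: eq_bigr => i _; rewrite mxE.
rewrite col00 => /(congr1 (mulmx (invmx (homog_mx p : 'M[R]_n.+1)))).
rewrite mulKmx// mulmx0.
by move=> /colP y0 i; have := y0 i; rewrite !mxE.
Qed.

(** The barycentric coordinates of [x] with respect to [p], meaningful when [p]
    is affinely independent. *)
Definition bary (R : realType) (n : nat) (p : 'I_n.+1 -> 'cV[R]_n) (x : 'cV[R]_n)
  : 'cV[R]_n.+1 := invmx (homog_mx p : 'M[R]_n.+1) *m homog x.

Lemma baryP (R : realType) (n : nat) (p : 'I_n.+1 -> 'cV[R]_n) (x : 'cV[R]_n) :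
  affinely_independent p ->
  \sum_i bary p x i 0 = 1 /\ \sum_i bary p x i 0 *: p i = x.
Proof. by move=> /homog_mx_unit up; apply/homog_mxP; rewrite mulKVmx. Qed.

(** Any two simplices are affinely equivalent, which is why the distance to a
    simplex does not depend on the choice of the simplex. *)
Lemma affine_bijection (R : realType) (n : nat) (p q : 'I_n.+1 -> 'cV[R]_n) :
  affinely_independent p -> affinely_independent q ->
  exists (A : 'M[R]_n) (v : 'cV[R]_n),
    A \in unitmx /\ forall k, p k = A *m q k + v.
Proof.
move=> ip iq; have uq := iq; move/homog_mx_unit in uq.
pose P : 'M[R]_(n, n.+1) := \matrix_(i, j) p j i 0.
have PE y : P *m y = \sum_i y i 0 *: p i.
  apply/colP => i; rewrite mxE summxE; apply: eq_bigr => j _.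
  by rewrite !mxE mulrC.
pose B : 'M[R]_(n, 1 + n) := P *m invmx (homog_mx q : 'M[R]_n.+1).
exists (rsubmx B), (lsubmx B); split.
  apply: mulmx_inj_unit => z Az0.
  pose y := invmx (homog_mx q : 'M[R]_n.+1) *m (col_mx 0%:M z : 'cV_(1 + n)).
  have [y0 yz] : \sum_i y i 0 = 0 /\ \sum_i y i 0 *: q i = z.
    by apply/homog_mxP; rewrite mulKVmx.
  have Py : \sum_i y i 0 *: p i = 0.
    rewrite -PE; transitivity (B *m (col_mx 0%:M z : 'cV_(1 + n))).
      exact: mulmxA.
    by rewrite -[B]hsubmxK mul_row_col Az0 raddf0 mulmx0 addr0.
  by rewrite -yz big1 // => i _; rewrite (ip (fun i => y i 0)) ?scale0r.
move=> k.
have <- : B *m homog (q k) = p k.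
  have -> : homog (q k) = homog_mx q *m (delta_mx k 0 : 'cV_n.+1).
    apply/colP => i; rewrite [RHS]mxE (bigD1 k)//= big1 ?addr0 => [|j /negbTE jk].
      by rewrite [in RHS]mxE [delta_mx _ _ _ _]mxE !eqxx mulr1.
    by rewrite [delta_mx _ _ _ _]mxE jk mulr0.
  rewrite /B -mulmxA mulKmx// PE (bigD1 k)//= big1 ?addr0 => [|j /negbTE jk].
    by rewrite mxE !eqxx scale1r.
  by rewrite mxE jk scale0r.
by rewrite -{1}[B]hsubmxK mul_row_col mulmx1 addrC.
Qed.

(** If the barycentric coordinates of [x] are at least [- m i], adding [m i] to
    each and dividing by [1 + sum m] gives barycentric coordinates of a point of
    the inscribed simplex; hence [K] lies in a translate of that simplex dilated
    by [1 + sum m]. *)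
Lemma inscribed_simplex_ratio (R : realType) (n : nat) (K S : set 'cV[R]_n)
    (p : 'I_n.+1 -> 'cV[R]_n) (m : 'I_n.+1 -> R) :
  convex_set K -> simplex S -> affinely_independent p -> (forall i, K (p i)) ->
  (forall i, 0 <= m i) ->
  (forall x, K x -> exists y : 'I_n.+1 -> R,
     [/\ \sum_i y i = 1, x = \sum_i y i *: p i & forall i, - m i <= y i]) ->
  [set rho : R | 0 <= rho /\
    exists (A : 'M[R]_n) (u v : 'cV[R]_n),
      [/\ A \in unitmx,
          [set u + x | x in K] `<=` [set A *m y | y in S] &
          [set A *m y | y in S] `<=` [set v + rho *: x | x in K]]]
   (1 + \sum_i m i).
Proof.
move=> cK [q iq ->] ip Kp m0 Ky.
have [A [v [uA pq]]] := affine_bijection ip iq.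
set rho := 1 + _; have r0 : 0 < rho by rewrite ltr_pwDl// sumr_ge0.
rewrite /= convex_hull_range; split; first exact: ltW.
exists (rho *: A), (\sum_i m i *: p i - rho *: v), (- (rho *: v)); split.
- by rewrite unitmxZ// unitfE gt_eqF.
- move=> _ [x /Ky[y [y1 xy ym]] <-].
  exists (\sum_i ((y i + m i) / rho) *: q i).
    exists (fun i => (y i + m i) / rho); split=> // [i|].
      by rewrite divr_ge0 ?(ltW r0)// -lerBlDr sub0r.
    by rewrite -mulr_suml big_split/= y1 divff// gt_eqF.
  rewrite xy -scalemxAl mulmx_sumr scaler_sumr addrAC -big_split/=.
  have -> : rho *: v = \sum_i (y i + m i) *: v.
    by rewrite -scaler_suml big_split/= y1.
  rewrite -sumrB; apply: eq_bigr => i _.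
  rewrite -scalemxAr scalerA mulrC divfK ?gt_eqF//.
  by rewrite -scalerDl pq (addrC (m i)) scalerDr addrK.
- move=> _ [_ [c [c0 c1 ->]] <-].
  exists (\sum_i c i *: p i); first exact: convex_set_sum.
  rewrite -scalemxAl -scalerN -scalerDr; congr (_ *: _).
  rewrite mulmx_sumr -[v]scale1r -c1 scaler_suml addrC -sumrB.
  apply: eq_bigr => i _.
  by rewrite pq scalerDr addrK scalemxAr.
Qed.

(** * Stochastic matrices close to the identity *)

(** The weights are [del i / (1 - sig)], where [del i = 1 - mu i i] and [sig] is
    the largest value of [del i + del j] with [i != j].  The second property is
    immediate, because [del j <= sig - del i] for [j != i].  In the third,
    [sum del - sum del^2 <= eps - sig^2 / 2], since the two largest defects
    already contribute at least [sig^2 / 2] to the sum of squares, and the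
    quotient by [1 - sig] increases up to [sig = eps], where it equals the bound.
    Equality occurs for two defects equal to [eps / 2]. *)
Lemma stochastic_weights (R : realFieldType) (n : nat)
    (mu : 'I_n.+1 -> 'I_n.+1 -> R) (eps : R) :
  (0 < n)%N -> eps < 1 -> (forall i j, 0 <= mu i j) ->
  (forall i, \sum_j mu i j = 1) -> \sum_i (1 - mu i i) <= eps ->
  exists g : 'I_n.+1 -> R,
    [/\ forall i, 0 <= g i,
        forall i, (1 - mu i i) + \sum_(j | j != i) mu i j * g j <= mu i i * g i &
        \sum_i mu i i * g i <= eps + eps ^+ 2 / (2 * (1 - eps))].
Proof.
move=> n0 e1 mu0 mu1; pose del i := 1 - mu i i; rewrite -/(del _) => dele.
have del0 i : 0 <= del i.
  by rewrite /del subr_ge0 -(mu1 i) (bigD1 i)//= lerDl sumr_ge0.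
have delE i : del i = \sum_(j | j != i) mu i j.
  by apply/eqP; rewrite /del subr_eq -(mu1 i) (bigD1 i)//= addrC.
have muE i : mu i i = 1 - del i by rewrite /del opprB addrCA subrr addr0.
have [[a b] /= ab sigP] : exists2 p : 'I_n.+1 * 'I_n.+1, p.1 != p.2 &
    forall i j, i != j -> del i + del j <= del p.1 + del p.2.
  (* [ord0] and [ord_max] are distinct because [n > 0]. *)
  pose p0 : 'I_n.+1 * 'I_n.+1 := (ord0, ord_max).
  have p0P : p0.1 != p0.2 by rewrite -val_eqE /= lt0n in n0 *; rewrite eq_sym.
  case: (@arg_maxP _ _ _ p0 (fun p => p.1 != p.2) (fun p => del p.1 + del p.2) p0P) => p pP pM.
  by exists p => // i j ij; apply: (pM (i, j)).
set sig := del a + del b in sigP.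
have split_sum (f : 'I_n.+1 -> R) :
    \sum_i f i = f a + f b + \sum_(i | (i != a) && (i != b)) f i.
  by rewrite (bigD1 a)//= (bigD1 b)//= 1?eq_sym// addrA.
have sige : sig <= eps.
  apply: le_trans dele; rewrite split_sum lerDl.
  by apply: sumr_ge0 => i _; exact: del0.
have s1 : 0 < 1 - sig by rewrite subr_gt0 (le_lt_trans sige).
exists (fun i => del i / (1 - sig)); split=> [i|i|].
- by rewrite divr_ge0 ?del0// ltW.
- have : \sum_(j | j != i) mu i j * (del j / (1 - sig)) <=
         \sum_(j | j != i) mu i j * ((sig - del i) / (1 - sig)).
    apply: ler_sum => j ji; rewrite ler_wpM2l// ler_pM2r ?invr_gt0//.
    by rewrite lerBrDl sigP// eq_sym.
  rewrite -mulr_suml -delE -/(del i) muE => H.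
  apply: le_trans (lerD (lexx _) H) _; rewrite le_eqVlt; apply/orP; left.
  by apply/eqP; field; rewrite gt_eqF.
- under eq_bigr do rewrite muE mulrA.
  rewrite -mulr_suml ler_pdivrMr//.
  have -> : \sum_i (1 - del i) * del i = \sum_i del i - \sum_i del i ^+ 2.
    by rewrite -sumrB; apply: eq_bigr => i _; ring.
  have sq : sig ^+ 2 / 2 <= \sum_i del i ^+ 2.
    rewrite split_sum; apply: (@le_trans _ _ (del a ^+ 2 + del b ^+ 2)).
      by rewrite /sig; have := sqr_ge0 (del a - del b); nra.
    by rewrite lerDl; apply: sumr_ge0 => i _; exact: sqr_ge0.
  apply: (@le_trans _ _ (eps - sig ^+ 2 / 2)); first by apply: lerB.
  have -> : eps + eps ^+ 2 / (2 * (1 - eps)) =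
      (eps - eps ^+ 2 / 2) / (1 - eps) by field; lra.
  have e1' : 0 < 1 - eps by lra.
  rewrite [leRHS]mulrAC ler_pdivlMr//.
  have sig0 : 0 <= sig by rewrite addr_ge0.
  rewrite -subr_ge0.
  have -> : (eps - eps ^+ 2 / 2) * (1 - sig) - (eps - sig ^+ 2 / 2) * (1 - eps) =
      (eps - sig) * ((eps - sig) / 2 + eps * sig / 2) by field.
  have eps0 := le_trans sig0 sige.
  by rewrite mulr_ge0 ?subr_ge0// addr_ge0// divr_ge0 ?subr_ge0// mulr_ge0.
Qed.


(** Pairing the weights with the off-diagonal part of [mu]: exchanging the two
    summations turns column sums, which carry no bound, into the row sums that
    the weights control. *)
Lemma weighted_defect (R : realFieldType) (n : nat)
    (mu : 'I_n.+1 -> 'I_n.+1 -> R) (g w : 'I_n.+1 -> R) :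
  (forall i, (1 - mu i i) + \sum_(j | j != i) mu i j * g j <= mu i i * g i) ->
  (forall i, 0 <= w i) ->
  \sum_i (1 - mu i i) * w i + \sum_j g j * (\sum_(i | i != j) mu i j * w i)
    <= \sum_i g i * (mu i i * w i).
Proof.
move=> gP w0.
have -> : \sum_j g j * (\sum_(i | i != j) mu i j * w i) =
    \sum_i (\sum_(j | j != i) mu i j * g j) * w i.
  under eq_bigr do rewrite mulr_sumr.
  under [RHS]eq_bigr do rewrite mulr_suml.
  rewrite (exchange_big_dep xpredT)//=; apply: eq_bigr => i _.
  by apply: eq_big => j; [rewrite eq_sym|move=> _; ring].
rewrite -big_split/=; apply: ler_sum => i _.
by rewrite -mulrDl mulrA (mulrC (g i)) ler_wpM2r.
Qed.

(** The weights show more than diagonal dominance, which fails as soon as one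
    defect exceeds 1/2.  For a vector in the kernel the weighted inequality
    forces [v i = 0] wherever the defect of row [i] is positive, and a row of
    zero defect has no off-diagonal entry. *)
Lemma stochastic_injective (R : realFieldType) (n : nat)
    (mu : 'I_n.+1 -> 'I_n.+1 -> R) (g v : 'I_n.+1 -> R) :
  (forall i j, 0 <= mu i j) -> (forall i, \sum_j mu i j = 1) ->
  (forall i, 0 < mu i i) -> (forall i, 0 <= g i) ->
  (forall i, (1 - mu i i) + \sum_(j | j != i) mu i j * g j <= mu i i * g i) ->
  (forall j, \sum_i v i * mu i j = 0) -> forall i, v i = 0.
Proof.
move=> mu0 mu1 mud g0 gP vmu.
have vd j : mu j j * `|v j| <= \sum_(i | i != j) mu i j * `|v i|.
  have := vmu j; rewrite (bigD1 j)//= => /eqP; rewrite addr_eq0 => /eqP vj.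
  rewrite -[mu j j]ger0_norm// -normrM mulrC vj normrN.
  apply: le_trans (ler_norm_sum _ _ _) _; apply: ler_sum => i _.
  by rewrite normrM mulrC ger0_norm.
have del0 i j : j != i -> mu i j <= 1 - mu i i.
  move=> ji; rewrite lerBrDl -(mu1 i) (bigD1 i)//= lerD2l.
  by rewrite (bigD1 j)//= lerDl sumr_ge0.
have del0' i : 0 <= 1 - mu i i.
  by rewrite subr_ge0 -(mu1 i) (bigD1 i)//= lerDl sumr_ge0.
have vz i : (1 - mu i i) * `|v i| = 0.
  have H : \sum_i (1 - mu i i) * `|v i| <= 0.
    have := weighted_defect gP (fun i => normr_ge0 (v i)).
    have : \sum_j g j * (mu j j * `|v j|) <=
           \sum_j g j * (\sum_(i | i != j) mu i j * `|v i|).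
      by apply: ler_sum => j _; rewrite ler_wpM2l.
    lra.
  apply/eqP; rewrite eq_le mulr_ge0// andbT; apply: le_trans H.
  by rewrite (bigD1 i)//= lerDl sumr_ge0// => k _; rewrite mulr_ge0.
move=> i; apply/eqP; rewrite -normr_eq0 -(mulrI_eq0 _ (mulfI (lt0r_neq0 (mud i)))).
rewrite eq_le mulr_ge0// andbT; apply: le_trans (vd i) _.
apply: sumr_le0 => k ki; rewrite -[X in _ <= X](vz k) ler_wpM2r// del0// eq_sym //.
Qed.

(** Only the sum [w = u + m] is needed: the two hypotheses add up to one
    inequality for [w], which the weights turn into a bound on the sum of
    [(1 - mu i i) * w i], and this sum dominates that of [m]. *)
Lemma stochastic_sum_bound (R : realFieldType) (n : nat)
    (mu : 'I_n.+1 -> 'I_n.+1 -> R) (g m u : 'I_n.+1 -> R) :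
  (forall i j, 0 <= mu i j) -> (forall i, \sum_j mu i j = 1) ->
  (forall i, 0 <= g i) ->
  (forall i, (1 - mu i i) + \sum_(j | j != i) mu i j * g j <= mu i i * g i) ->
  (forall i, 0 <= m i) -> (forall i, 0 <= u i) ->
  (forall j, mu j j * m j <= \sum_(i | i != j) mu i j * u i) ->
  (forall j, mu j j * u j <= mu j j + \sum_(i | i != j) mu i j * m i) ->
  \sum_i m i <= \sum_i mu i i * g i.
Proof.
move=> mu0 mu1 g0 gP m0 u0 mP uP.
have H1 := weighted_defect gP (fun i => addr_ge0 (u0 i) (m0 i)).
have H2 : \sum_j g j * (mu j j * (u j + m j)) <= \sum_j mu j j * g j +
    \sum_j g j * (\sum_(i | i != j) mu i j * (u i + m i)).
  rewrite -big_split/=; apply: ler_sum => j _.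
  rewrite [mu j j * g j]mulrC -mulrDr ler_wpM2l//.
  under eq_bigr do rewrite mulrDr.
  rewrite big_split/=; have := mP j; have := uP j; lra.
have H3 : \sum_j mu j j * m j <= \sum_i (1 - mu i i) * u i.
  apply: (@le_trans _ _ (\sum_j \sum_(i | i != j) mu i j * u i)).
    by apply: ler_sum => j _.
  rewrite (exchange_big_dep xpredT)//=; apply: ler_sum => i _.
  rewrite -mulr_suml ler_wpM2r// lerBrDl -(mu1 i) [leRHS](bigD1 i)//= lerD2l.
  by under eq_bigl do rewrite eq_sym.
have -> : \sum_i m i = \sum_j mu j j * m j + \sum_i (1 - mu i i) * m i.
  by rewrite -big_split/=; apply: eq_bigr => i _; ring.
have E : \sum_i (1 - mu i i) * (u i + m i) =
    \sum_i (1 - mu i i) * u i + \sum_i (1 - mu i i) * m i.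
  by rewrite -big_split/=; apply: eq_bigr => i _; ring.
lra.
Qed.

(** * Affine functions and compactness *)

(** The norm of the ambient space is the sup norm, so the Euclidean structure
    used for separation is introduced separately. *)
Definition dot (R : realType) (n : nat) (x y : 'cV[R]_n) : R := (x^T *m y) 0 0.

Lemma dotE (R : realType) (n : nat) (x y : 'cV[R]_n) :
  dot x y = \sum_i x i 0 * y i 0.
Proof. by rewrite /dot mxE; apply: eq_bigr => i _; rewrite mxE. Qed.

Lemma dotC (R : realType) (n : nat) (x y : 'cV[R]_n) : dot x y = dot y x.
Proof. by rewrite !dotE; apply: eq_bigr => i _; rewrite mulrC. Qed.

Lemma dotDr (R : realType) (n : nat) (x y z : 'cV[R]_n) :
  dot x (y + z) = dot x y + dot x z.
Proof. by rewrite /dot mulmxDr mxE. Qed.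

Lemma dotZr (R : realType) (n : nat) (a : R) (x y : 'cV[R]_n) :
  dot x (a *: y) = a * dot x y.
Proof. by rewrite /dot -scalemxAr mxE. Qed.

Lemma dotNr (R : realType) (n : nat) (x y : 'cV[R]_n) : dot x (- y) = - dot x y.
Proof. by rewrite /dot mulmxN mxE. Qed.

Lemma dotDl (R : realType) (n : nat) (x y z : 'cV[R]_n) :
  dot (y + z) x = dot y x + dot z x.
Proof. by rewrite ![dot _ x]dotC dotDr. Qed.

Lemma dotZl (R : realType) (n : nat) (a : R) (x y : 'cV[R]_n) :
  dot (a *: y) x = a * dot y x.
Proof. by rewrite ![dot _ x]dotC dotZr. Qed.

Lemma dotNl (R : realType) (n : nat) (x y : 'cV[R]_n) : dot (- y) x = - dot y x.
Proof. by rewrite ![dot _ x]dotC dotNr. Qed.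

Lemma dot_sumr (R : realType) (n : nat) (I : finType) (x : 'cV[R]_n)
    (y : I -> 'cV[R]_n) :
  dot x (\sum_i y i) = \sum_i dot x (y i).
Proof. by rewrite /dot mulmx_sumr summxE. Qed.

Lemma dot_suml (R : realType) (n : nat) (I : finType) (x : 'cV[R]_n)
    (y : I -> 'cV[R]_n) :
  dot (\sum_i y i) x = \sum_i dot (y i) x.
Proof. by rewrite dotC dot_sumr; apply: eq_bigr => i _; rewrite dotC. Qed.

Lemma dot_ge0 (R : realType) (n : nat) (x : 'cV[R]_n) : 0 <= dot x x.
Proof. by rewrite dotE sumr_ge0// => i _; rewrite -expr2 sqr_ge0. Qed.

Lemma dot_eq0 (R : realType) (n : nat) (x : 'cV[R]_n) : dot x x = 0 -> x = 0.
Proof.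
rewrite dotE => /eqP; rewrite psumr_eq0 => [|i _]; last by rewrite -expr2 sqr_ge0.
move=> /allP x0; apply/colP => i; rewrite mxE.
by have := x0 i (mem_index_enum _); rewrite /= mulf_eq0 orbb => /eqP.
Qed.

Lemma continuous_sum (R : realType) (T : topologicalType) (I : finType)
    (f : I -> T -> R) :
  (forall i, continuous (f i)) -> continuous (fun x => \sum_i f i x).
Proof.
move=> cf x; apply: cvg_big; last by move=> i _; exact: cf.
exact: add_continuous.
Qed.

(** Row [i] of [G] lists the constant term and then the linear coefficients of
    an affine function. *)
Definition affine_form (R : realType) (n N : nat) (G : 'M[R]_(N, 1 + n)) (i : 'I_N)
  (x : 'cV[R]_n) : R := (G *m homog x) i 0.

Lemma affine_formE (R : realType) (n N : nat) (G : 'M[R]_(N, 1 + n)) (i : 'I_N)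
    (x : 'cV[R]_n) :
  affine_form G i x = G i (lshift n 0) + \sum_k G i (rshift 1 k) * x k 0.
Proof.
rewrite /affine_form mxE big_split_ord/= big_ord1 col_mxEu mxE eqxx mulr1.
by congr (_ + _); apply: eq_bigr => k _; rewrite col_mxEd.
Qed.

Lemma affine_form_continuous (R : realType) (n N : nat) (G : 'M[R]_(N, 1 + n))
    (i : 'I_N) : continuous (affine_form G i).
Proof.
rewrite (_ : affine_form G i = fun x => G i (lshift n 0) +
    \sum_k G i (rshift 1 k) * x k 0); last by apply/funext => x; rewrite affine_formE.
move=> x; apply: continuousD; first exact: cst_continuous.
apply: (@continuous_sum _ _ _ (fun k (x : 'cV[R]_n) => G i (rshift 1 k) * x k 0)).
move=> k y; apply: continuousM; first exact: cst_continuous.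
exact: coord_continuous.
Qed.

Lemma affine_form_max (R : realType) (n N : nat) (G : 'M[R]_(N, 1 + n)) (i : 'I_N)
    (K : set 'cV[R]_n) : compact K -> K !=set0 ->
  exists2 p, K p & forall x, K x -> affine_form G i x <= affine_form G i p.
Proof.
move=> cK K0; have [//|p pK pM] := compact_EVT_max K0 cK (f := affine_form G i).
  exact/continuous_subspaceT/affine_form_continuous.
by exists p => [|x Kx]; [exact: set_mem|apply/pM/mem_set].
Qed.

(** A point [e] lies in [x + rho K] for every [x] in [K] iff the centre
    [e / (1 + rho)] witnesses asymmetry at most [rho]; the compactness of these
    translates reduces the absence of such a point to finitely many [x]. *)
Lemma finite_avoidance (R : realType) (n : nat) (K : set 'cV[R]_n) (rho : R) :
  compact K -> K !=set0 ->
  (forall e, exists2 x, K x & forall k, K k -> e <> x + rho *: k) ->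
  exists N (x : 'I_N -> 'cV[R]_n), (forall i, K (x i)) /\
    forall e, exists i, forall k, K k -> e <> x i + rho *: k.
Proof.
move=> cK [x0 Kx0] avoid; pose F (x : 'cV[R]_n) := [set x + rho *: k | k in K].
have cF x : compact (F x).
  apply: continuous_compact => //; apply: continuous_subspaceT => y.
  apply: continuousD; first exact: cst_continuous.
  by apply: continuousZl_tmp; exact: cvg_id.
have := cF x0; rewrite compact_cover => /(_ _ K (fun x => ~` F x)).
case=> [x _|e _|D DK cov].
- by rewrite openC; apply: compact_closed => //; exact: norm_hausdorff.
- by have [x Kx xe] := avoid e; exists x => // -[k Kk /esym]; exact: xe.
pose s := x0 :: finmap.enum_fset D.
exists (size s), (fun i => nth x0 s i); split => [i|e].
  have : nth x0 s i \in s by apply: mem_nth.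
  by rewrite inE => /predU1P[->//|/DK/set_mem].
have [[k Kk ke]|nF] := pselect (F x0 e); last first.
  by exists ord0 => k Kk ek; apply: nF; exists k.
have [|x /= xD nF] := cov e; first by exists k.
have xs : (index x s < size s)%N by rewrite index_mem inE xD orbT.
exists (Ordinal xs) => l Kl /=; rewrite nth_index -?index_mem// => el.
by apply: nF; exists l.
Qed.

(** * Duality for the Minkowski asymmetry *)

(** This is [N^2] times the variance of the points [z i]; unlike the variance it
    involves no division, and it vanishes exactly when they all coincide. *)
Definition spread (R : realType) (n N : nat) (z : 'I_N -> 'cV[R]_n) : R :=
  N%:R * \sum_i dot (z i) (z i) - dot (\sum_i z i) (\sum_i z i).

(** Moving a single point changes [spread] by a quadratic polynomial whose linear
    part is given by the deviation of that point from the mean. *)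
Lemma spread_shift (R : realType) (n N : nat) (z : 'I_N -> 'cV[R]_n) (i : 'I_N)
    (w : 'cV[R]_n) :
  spread (fun j => z j + (j == i)%:R *: w) =
  spread z + 2 * dot (N%:R *: z i - \sum_j z j) w + (N%:R - 1) * dot w w.
Proof.
have sE : \sum_j (z j + (j == i)%:R *: w) = \sum_j z j + w.
  rewrite big_split/=; congr (_ + _).
  rewrite (bigD1 i)//= eqxx scale1r big1 ?addr0// => j /negbTE ->.
  by rewrite scale0r.
have qE : \sum_j dot (z j + (j == i)%:R *: w) (z j + (j == i)%:R *: w) =
    \sum_j dot (z j) (z j) + (2 * dot (z i) w + dot w w).
  rewrite (bigD1 i)//= [X in _ = X + _](bigD1 i)//= eqxx scale1r.
  rewrite (eq_bigr (fun j => dot (z j) (z j))) => [|j /negbTE ->]; last first.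
    by rewrite scale0r addr0.
  by rewrite !(dotDl, dotDr) (dotC w); ring.
rewrite /spread sE qE !(dotDl, dotDr, dotNl, dotZl) (dotC w); ring.
Qed.

Lemma sum_spread (R : realType) (n N : nat) (z : 'I_N -> 'cV[R]_n) :
  let a i := \sum_j z j - N%:R *: z i in
  \sum_i dot (a i) (a i) = N%:R * spread z.
Proof.
move=> a; rewrite /spread; set s := \sum_j z j.
under eq_bigr => i _ do
  rewrite /a -/s !(dotDl, dotDr, dotNl, dotNr, dotZl, dotZr) (dotC (z i) s).
rewrite (eq_bigr (fun i => dot s s - 2 * N%:R * dot s (z i) +
   N%:R * N%:R * dot (z i) (z i))) => [|i _]; last by ring.
rewrite !big_split/= sumr_const card_ord sumrN -!mulr_sumr -dot_sumr -/s.
rewrite -mulr_natl; ring.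
Qed.

Lemma quadratic_slope (R : realType) (a b : R) :
  0 <= b -> (forall t, 0 < t <= 1 -> 0 <= a * t + b * t ^+ 2) -> 0 <= a.
Proof.
move=> b0 H; rewrite leNgt; apply/negP => a0.
(* Small enough for [a + b * t] to remain negative, and at most 1. *)
pose t := - a / (b + 1 - a).
have d0 : 0 < b + 1 - a by lra.
have t0 : 0 < t by rewrite divr_gt0// oppr_gt0.
have t1 : t <= 1 by rewrite ler_pdivrMr// mul1r; lra.
have := H t; rewrite t0 t1 => /(_ isT).
have -> : a * t + b * t ^+ 2 = (a + b * t) * t by ring.
rewrite pmulr_lge0//.
have tE : t * (b + 1 - a) = - a by rewrite divfK// gt_eqF.
nra.
Qed.

(** Choose one point in each translate so that [spread] is minimal.  The vectors
    from these points to their mean, scaled by [N], are the required functionals: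
    they add up to 0 by definition, first-order optimality says that each is
    maximised over its translate at the chosen point, and their total value there
    is [- spread], which is negative because the translates have no common
    point. *)
Lemma separation_of_translates (R : realType) (n N : nat) (K : set 'cV[R]_n) (rho : R)
    (x : 'I_N -> 'cV[R]_n) :
  compact K -> convex_set K -> K !=set0 -> 0 < rho ->
  (forall e, exists i, forall k, K k -> e <> x i + rho *: k) ->
  exists a k : 'I_N -> 'cV[R]_n,
    [/\ forall i, K (k i), \sum_i a i = 0,
        forall i y, K y -> dot (a i) y <= dot (a i) (k i) &
        \sum_i dot (a i) (x i) + rho * \sum_i dot (a i) (k i) < 0].
Proof.
move=> cK /convex_setP vK [k0 Kk0] r0 avoid.
pose z (k : 'I_N -> 'cV[R]_n) i := x i + rho *: k i.
pose KN : set (prod_topology (fun _ : 'I_N => 'cV[R]_n)) :=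
  [set k | forall i, K (k i)].
have cKN : compact KN by exact: (@tychonoff 'I_N (fun=> 'cV[R]_n) (fun=> K)).
have KN0 : KN !=set0 by exists (fun=> k0).
have cz i : continuous (fun k : prod_topology (fun _ : 'I_N => 'cV[R]_n) => z k i).
  move=> k; apply: (@continuous_comp _ _ _ (fun k : prod_topology _ => k i)
    (fun y : 'cV[R]_n => x i + rho *: y)); first exact: proj_continuous.
  apply: continuousD; first exact: cst_continuous.
  by apply: continuousZl_tmp; exact: cvg_id.
have czc i l : continuous
    (fun k : prod_topology (fun _ : 'I_N => 'cV[R]_n) => z k i l 0).
  move=> k; apply: (@continuous_comp _ _ _ (fun k : prod_topology _ => z k i)
    (fun y : 'cV[R]_n => y l 0)); [exact: cz|exact: coord_continuous].
have csp : continuous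
    (fun k : prod_topology (fun _ : 'I_N => 'cV[R]_n) => spread (z k)).
  rewrite (_ : (fun k => _) = (fun k => N%:R * (\sum_i \sum_l z k i l 0 * z k i l 0)
     - \sum_l (\sum_i z k i l 0) * (\sum_i z k i l 0))); last first.
    apply/funext => k; rewrite /spread dotE; congr (_ * _ - _).
      by apply: eq_bigr => i _; rewrite dotE.
    by apply: eq_bigr => l _; rewrite !summxE.
  have cM (f g : prod_topology (fun _ : 'I_N => 'cV[R]_n) -> R) :
      continuous f -> continuous g -> continuous (fun k => f k * g k).
    by move=> cf cg k; apply: continuousM; [exact: cf|exact: cg].
  have c1 : continuous (fun k : prod_topology (fun _ : 'I_N => 'cV[R]_n) =>
      N%:R * \sum_i \sum_l z k i l 0 * z k i l 0).
    apply: (cM _ _); first exact: cst_continuous.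
    by apply: continuous_sum => i; apply: continuous_sum => l; apply: (cM _ _).
  have c2 : continuous (fun k : prod_topology (fun _ : 'I_N => 'cV[R]_n) =>
      \sum_l (\sum_i z k i l 0) * (\sum_i z k i l 0)).
    by apply: continuous_sum => l; apply: (cM _ _); apply: continuous_sum.
  by move=> k; exact: (continuousB (c1 k) (c2 k)).
have [|k kKN kmin] := compact_EVT_min KN0 cKN
  (f := fun k : prod_topology (fun _ : 'I_N => 'cV[R]_n) => spread (z k)).
  exact: continuous_subspaceT.
have Kk : forall i, K (k i) by move: kKN; rewrite inE.
pose a i := \sum_j z k j - N%:R *: z k i.
have sp_gt0 : 0 < spread (z k).
  rewrite ltNge; apply/negP => sp0.
  have a0 i : a i = 0.
    apply: dot_eq0; apply/eqP; rewrite eq_le dot_ge0 andbT.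
    apply: (@le_trans _ _ (N%:R * spread (z k))); last by rewrite mulr_ge0_le0.
    rewrite -sum_spread (bigD1 i)//= lerDl; apply: sumr_ge0 => j _; exact: dot_ge0.
  (* All points equal their mean, which is then common to all translates. *)
  have [i /(_ (k i) (Kk i))] := avoid (N%:R^-1 *: \sum_j z k j).
  apply; have /eqP := a0 i; rewrite subr_eq0 => /eqP ->.
  by rewrite scalerA mulVf ?scale1r// pnatr_eq0 -lt0n (leq_ltn_trans _ (ltn_ord i)).
exists a, k; split => //.
- rewrite sumrB sumr_const card_ord -scaler_sumr -scaler_nat; exact: subrr.
- move=> i y Ky; pose v := y - k i.
  suff : 0 <= 2 * rho * dot (- a i) v.
    by rewrite pmulr_rge0 ?mulr_gt0// dotNl oppr_ge0 /v dotDr dotNr subr_le0.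
  apply: (@quadratic_slope _ _ ((N%:R - 1) * rho ^+ 2 * dot v v)) => [|t /andP[t0 t1]].
    have N1 : 0 <= N%:R - 1 :> R.
      by rewrite subr_ge0 ler1n; exact: leq_ltn_trans (ltn_ord i).
    by apply: mulr_ge0; [apply: mulr_ge0; rewrite ?sqr_ge0|exact: dot_ge0].
  pose k' j := k j + (j == i)%:R *: (t *: v).
  have Kk' : k' \in KN.
    rewrite inE => j; rewrite /k'; have [->|_] := eqVneq j i; last first.
      by rewrite scale0r addr0.
    rewrite (_ : _ + _ = t *: y + (1 - t) *: k i) /v; first by apply: vK => //; rewrite ltW.
    by rewrite scale1r scalerBr scalerBl scale1r addrCA.
  have := kmin _ Kk'; rewrite (_ : z k' = fun j => z k j + (j == i)%:R *: (rho *: (t *: v))).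
    rewrite spread_shift -/(a i) -opprB -/(a i) !(dotZl, dotZr) => H.
    rewrite -(lerD2l (spread (z k))) addr0; apply: le_trans H _.
    rewrite le_eqVlt; apply/orP; left; apply/eqP; ring.
  by apply/funext => j; rewrite /z /k' scalerDr addrA !scalerA mulrCA mulrA.
- rewrite mulr_sumr -big_split/=.
  rewrite (eq_bigr (fun i => dot (a i) (z k i))) => [|i _]; last first.
    by rewrite /z dotDr dotZr.
  under eq_bigr => i _ do rewrite /a dotDl dotNl dotZl.
  by rewrite sumrB -dot_sumr -mulr_sumr -opprB oppr_lt0.
Qed.

(** A dual witness that the asymmetry of [K] exceeds [rho].  For a centre [c] and
    [x] in [K], the relation [(1 + rho) c = x + rho k] with [k] in [K] gives
    [(1 + rho) f_i c >= f_i x]; taking [x = p i] and summing would give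
    [1 + rho >= sum f_i (p i)]. *)
Definition asymmetry_certificate (R : realType) (n : nat) (K : set 'cV[R]_n)
    (rho : R) (N : nat) : Prop :=
  exists (G : 'M[R]_(N, 1 + n)) (p : 'I_N -> 'cV[R]_n),
    [/\ forall i, K (p i), forall i x, K x -> 0 <= affine_form G i x,
        forall x, \sum_i affine_form G i x = 1 &
        1 + rho < \sum_i affine_form G i (p i)].

Lemma affine_form_row (R : realType) (n N : nat) (G : 'M[R]_(N, 1 + n)) (i : 'I_N)
    (x : 'cV[R]_n) : affine_form G i x = (row i G *m homog x) 0 0.
Proof. by rewrite -row_mul mxE. Qed.

Lemma certificate_exists (R : realType) (n : nat) (K : set 'cV[R]_n) (rho : R) :
  compact K -> convex_set K -> K !=set0 -> 0 < rho ->
  (forall e, exists2 x, K x & forall k, K k -> e <> x + rho *: k) ->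
  exists N, asymmetry_certificate K rho N.
Proof.
move=> cK vK K0 r0 /(finite_avoidance cK K0)[N [x [Kx avoid]]].
have [a [k [Kk a0 aM neg]]] := separation_of_translates cK vK K0 r0 avoid.
set H := \sum_i dot (a i) (k i) in neg.
pose f i y := dot (a i) (k i) - dot (a i) y.
have f0 i y : K y -> 0 <= f i y by move=> Ky; rewrite subr_ge0 aM.
have fs y : \sum_i f i y = H by rewrite sumrB -dot_suml a0 /dot trmx0 mul0mx mxE subr0.
have fx : (1 + rho) * H < \sum_i f i (x i) by rewrite sumrB -/H; lra.
(* [H] is the constant sum of the nonnegative [f i]; if it were 0, each [f i]
   would vanish on [K], against [fx]. *)
have H0 : 0 < H.
  have fle i : f i (x i) <= H.
    by rewrite -(fs (x i)) (bigD1 i)//= lerDl sumr_ge0// => j _; exact: f0.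
  have [[i _]|N0] := pselect (exists i : 'I_N, True); last first.
    have noI (F : 'I_N -> R) : \sum_i F i = 0.
      by rewrite big1// => i _; case: N0; exists i.
    by move: fx; rewrite noI /H noI mulr0 ltxx.
  have Hge0 : 0 <= H by apply: le_trans (fle i); exact: f0.
  rewrite lt_def Hge0 andbT; apply/eqP => HE.
  move: fx; rewrite HE mulr0 ltNge; apply/negP; rewrite negbK.
  by apply: sumr_le0 => j _; rewrite -HE.
pose G : 'M[R]_(N, 1 + n) :=
  \matrix_i (row_mx (H^-1 * dot (a i) (k i))%:M (- H^-1 *: (a i)^T)).
have GE i y : affine_form G i y = H^-1 * f i y.
  rewrite affine_form_row rowK mul_row_col mulmx1 mxE -scalemxAl mxE mxE.
  by rewrite eqxx mulr1n /f mulrBr mulNr.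
exists N, G, x; split => // [i y Ky|y|].
- by rewrite GE mulr_ge0 ?f0// invr_ge0 ltW.
- by under eq_bigr do rewrite GE; rewrite -mulr_sumr fs mulVf// gt_eqF.
- under eq_bigr do rewrite GE.
  by rewrite -mulr_sumr mulrC ltr_pdivlMr.
Qed.

Lemma certificate_pad (R : realType) (n N : nat) (K : set 'cV[R]_n) (rho : R) :
  K !=set0 -> asymmetry_certificate K rho N -> asymmetry_certificate K rho N.+1.
Proof.
move=> [x0 Kx0] [G [p [Kp G0 G1 Gp]]].
pose G' : 'M[R]_(N.+1, 1 + n) :=
  \matrix_i (if unlift ord0 i is Some j then row j G else 0).
have G'E x : affine_form G' ord0 x = 0 /\
    forall j, affine_form G' (lift ord0 j) x = affine_form G j x.
  rewrite affine_form_row rowK unlift_none mul0mx mxE; split=> // j.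
  by rewrite !affine_form_row rowK liftK.
exists G', (fun i => if unlift ord0 i is Some j then p j else x0); split.
- by move=> i; case: (unlift _ _).
- move=> i x Kx; case: (unliftP ord0 i) => [j ->|->]; rewrite ?(G'E x).2 ?(G'E x).1//.
  exact: G0.
- move=> x; rewrite big_ord_recl (G'E x).1 add0r -(G1 x).
  by apply: eq_bigr => j _; rewrite (G'E x).2.
- rewrite big_ord_recl (G'E _).1 add0r.
  by under eq_bigr => j _ do rewrite liftK (G'E _).2.
Qed.

(** Affine functions on the space form a vector space of dimension [n + 1]. *)
Lemma affine_form_dependency (R : realType) (n N : nat) (G : 'M[R]_(N, 1 + n)) :
  (1 + n < N)%N -> exists2 t : 'I_N -> R, (exists i, t i != 0) &
    forall x, \sum_i t i * affine_form G i x = 0.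
Proof.
move=> nN; have /rowV0Pn[v /sub_kermxP vG v0] : kermx G != 0.
  rewrite kermx_eq0 -row_leq_rank -ltnNge; exact: leq_ltn_trans (rank_leq_col G) nN.
exists (fun i => v 0 i).
  by have /rV0Pn[i vi] := v0; exists i.
move=> x; transitivity ((v *m (G *m homog x)) 0 0); first by rewrite mxE.
by rewrite mulmxA vG mul0mx mxE.
Qed.

(** Caratheodory's argument.  Along a linear dependency [t] of the affine
    functions, the weights [1 + s t i] keep their sum equal to 1.  For one sign of
    [t] the total value does not decrease, and [s] may grow until a weight
    reaches 0, which removes one function. *)
Lemma certificate_shrink (R : realType) (n N : nat) (K : set 'cV[R]_n) (rho : R) :
  (n < N)%N -> asymmetry_certificate K rho N.+1 -> asymmetry_certificate K rho N.
Proof.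
move=> nN [G [p [Kp G0 G1 Gp]]].
pose f := affine_form G.
have [t [[k tk] tf tp]] : exists t : 'I_N.+1 -> R,
    [/\ exists i, t i < 0, forall x, \sum_i t i * f i x = 0 &
        0 <= \sum_i t i * f i (p i)].
  have [t0 [j t0j] t0f] := affine_form_dependency G (nN : (1 + n < N.+1)%N).
  have [t [[h th] tf tp]] : exists t : 'I_N.+1 -> R,
      [/\ exists i, t i != 0, forall x, \sum_i t i * f i x = 0 &
          0 <= \sum_i t i * f i (p i)].
    have [tp|tp] := leP 0 (\sum_i t0 i * f i (p i)).
      by exists t0; split=> //; exists j.
    exists (fun i => - t0 i); split; first by exists j; rewrite oppr_eq0.
    - by move=> x; under eq_bigr do rewrite mulNr; rewrite sumrN t0f oppr0.
    - by under eq_bigr do rewrite mulNr; rewrite sumrN oppr_ge0 ltW.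
  (* If [t >= 0], then each [t i * f i] vanishes on [K], being a nonnegative
     term of a null sum; the total value is 0 and [- t] can be used instead. *)
  have [nt|pt] := pselect (exists i, t i < 0); first by exists t.
  have {}pt i : 0 <= t i by rewrite leNgt; apply/negP => ti; apply: pt; exists i.
  exists (fun i => - t i); split.
  - by exists h; rewrite oppr_lt0 lt_def th pt.
  - by move=> x; under eq_bigr do rewrite mulNr; rewrite sumrN tf oppr0.
  - rewrite big1// => i _; apply/eqP; rewrite mulNr oppr_eq0.
    have := tf (p i) => /eqP; rewrite psumr_eq0 => [|l _]; last first.
      by rewrite mulr_ge0//; exact: G0.
    by move=> /allP/(_ i (mem_index_enum _)).
(* The most negative [t i] is the first whose weight reaches 0. *)
have [i0 _ i0min] := arg_minP t (isT : xpredT k).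
have ti0 : t i0 < 0 by apply: le_lt_trans tk; exact: i0min.
pose w i := 1 - t i / t i0.
have w0 i : 0 <= w i by rewrite subr_ge0 ler_ndivrMr// mul1r i0min.
have wi0 : w i0 = 0 by rewrite /w divff ?subrr// lt_eqF.
pose G' : 'M[R]_(N, 1 + n) := \matrix_i (w (lift i0 i) *: row (lift i0 i) G).
have G'E i x : affine_form G' i x = w (lift i0 i) * f (lift i0 i) x.
  by rewrite affine_form_row rowK -scalemxAl mxE /f affine_form_row.
have wsum (F : 'I_N.+1 -> R) :
    \sum_(i < N) w (lift i0 i) * F (lift i0 i) =
    \sum_i F i - (\sum_i t i * F i) / t i0.
  transitivity (\sum_i w i * F i).
    by rewrite [RHS](bigD1_ord i0)//= wi0 mul0r add0r.
  rewrite mulr_suml -sumrB; apply: eq_bigr => i _.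
  by rewrite /w mulrBl mul1r mulrAC.
exists G', (fun i => p (lift i0 i)); split=> [//|i x Kx|x|].
- by rewrite G'E mulr_ge0//; exact: G0.
- under eq_bigr do rewrite G'E.
  by rewrite (wsum (fun i => f i x)) tf mul0r subr0 G1.
- under eq_bigr do rewrite G'E.
  rewrite (wsum (fun i => f i (p i))); apply: lt_le_trans Gp _.
  by rewrite lerDl oppr_ge0 mulr_ge0_le0// invr_le0 ltW.
Qed.

Lemma certificate_size (R : realType) (n : nat) (K : set 'cV[R]_n) (rho : R) :
  compact K -> convex_set K -> K !=set0 -> 0 < rho ->
  (forall e, exists2 x, K x & forall k, K k -> e <> x + rho *: k) ->
  asymmetry_certificate K rho n.+1.
Proof.
move=> cK vK K0 r0 /(certificate_exists cK vK K0 r0)[N].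
have [Nn|nN] := leqP N n.+1.
  rewrite -(subnK Nn); elim: (n.+1 - N)%N => // d IH /IH; exact: certificate_pad.
rewrite -(subnK (ltnW nN)); elim: (N - n.+1)%N => // d IH C; apply: IH.
by apply: certificate_shrink C; exact: leq_addl.
Qed.

(** * The upper bound on the distance *)

Lemma affine_form_comb (R : realType) (n N m : nat) (G : 'M[R]_(N, 1 + n)) (j : 'I_N)
    (p : 'I_m -> 'cV[R]_n) (c : 'I_m -> R) :
  \sum_i c i * affine_form G j (p i) =
  (G *m (col_mx (\sum_i c i)%:M (\sum_i c i *: p i) : 'cV_(1 + n))) j 0.
Proof.
transitivity ((G *m homog_mx p *m (\col_i c i)) j 0).
  rewrite mxE; apply: eq_bigr => i _; rewrite [in RHS]mxE mulrC; congr (_ * _).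
    by rewrite /affine_form !mxE; apply: eq_bigr => k _; rewrite [homog_mx _ _ _]mxE.
  by rewrite mxE.
rewrite -mulmxA homog_mxM; congr ((_ *m col_mx _%:M _) _ _).
  by apply: eq_bigr => i _; rewrite mxE.
by apply: eq_bigr => i _; rewrite mxE.
Qed.

Lemma bary_vertex (R : realType) (n : nat) (p : 'I_n.+1 -> 'cV[R]_n) (i j : 'I_n.+1) :
  affinely_independent p -> bary p (p i) j 0 = (j == i)%:R.
Proof.
move=> ip; have [b1 bp] := baryP (p i) ip.
pose c (k : 'I_n.+1) : R := (k == i)%:R.
have c1 : \sum_k c k = 1.
  by rewrite (bigD1 i)//= /c eqxx big1 ?addr0// => k /negbTE ->.
have cp : \sum_k c k *: p k = p i.
  rewrite (bigD1 i)//= /c eqxx scale1r big1 ?addr0// => k /negbTE ->.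
  by rewrite scale0r.
apply/eqP; rewrite -subr_eq0; apply/eqP.
apply: (ip (fun k => bary p (p i) k 0 - c k)).
  by rewrite sumrB b1 c1 subrr.
under eq_bigr do rewrite scalerBl.
by rewrite sumrB bp cp subrr.
Qed.

(** The points are first replaced by maximisers of the functions: besides
    enlarging the total value, this yields [f j <= mu j j] on [K], which bounds
    the barycentric coordinates from above. *)
Lemma banach_mazur_le_of_certificate (R : realType) (n : nat) (K S : set 'cV[R]_n)
    (eps : R) :
  (0 < n)%N -> compact K -> convex_set K -> simplex S -> eps < 1 ->
  asymmetry_certificate K (n%:R - eps) n.+1 ->
  banach_mazur K S <= 1 + eps + eps ^+ 2 / (2 * (1 - eps)).
Proof.
move=> n0 cK vK sS e1 [G [p0 [Kp0 G0 G1 Gp0]]].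
have K0 : K !=set0 by exists (p0 ord0).
pose f := affine_form G.
have /choice[p pP] : forall i, exists p, K p /\ forall x, K x -> f i x <= f i p.
  by move=> i; have [p] := affine_form_max G i cK K0; exists p.
have Kp i : K (p i) by have [] := pP i.
have pM i x : K x -> f i x <= f i (p i) by have [_] := pP i; exact.
pose mu i j := f j (p i).
have mu0 i j : 0 <= mu i j by exact: G0.
have mu1 i : \sum_j mu i j = 1 by exact: G1.
have defect : \sum_i (1 - mu i i) <= eps.
  rewrite sumrB sumr_const card_ord -mulr_natl mulr1 -natr1.
  have : \sum_i f i (p0 i) <= \sum_i mu i i by apply: ler_sum => i _; exact: pM.
  by move: Gp0; rewrite -/f; lra.
have def0 i : 0 <= 1 - mu i i.
  by rewrite subr_ge0 -(mu1 i) (bigD1 i)//= lerDl sumr_ge0.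
have mud i : 0 < mu i i.
  have : 1 - mu i i <= eps.
    by apply: le_trans defect; rewrite (bigD1 i)//= lerDl sumr_ge0.
  by lra.
have [g [g0 gP gS]] := stochastic_weights n0 e1 mu0 mu1 defect.
have ip : affinely_independent p.
  move=> a a0 ap; apply: (stochastic_injective mu0 mu1 mud g0 gP) => j.
  by rewrite affine_form_comb a0 ap raddf0 col_mx0 mulmx0 mxE.
pose y x i : R := bary p x i 0.
have fy j x : f j x = \sum_i y x i * mu i j.
  by rewrite affine_form_comb; have [-> ->] := baryP x ip.
have /choice[xm xmP] : forall i, exists x, K x /\ forall z, K z -> y x i <= y z i.
  move=> i.
  have [x Kx xM] := affine_form_max (- (invmx (homog_mx p : 'M[R]_n.+1))
    : 'M[R]_(n.+1, 1 + n)) i cK K0.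
  exists x; split => // z /xM.
  by rewrite /affine_form !mulNmx [_ i 0]mxE [in leRHS]mxE lerN2.
have /choice[xM xMP] : forall i, exists x, K x /\ forall z, K z -> y z i <= y x i.
  move=> i.
  have [x Kx xM] := affine_form_max (invmx (homog_mx p : 'M[R]_n.+1)
    : 'M[R]_(n.+1, 1 + n)) i cK K0.
  by exists x; split => // z /xM.
pose m i := - y (xm i) i; pose u i : R := y (xM i) i.
have mle i x : K x -> - m i <= y x i by rewrite opprK => Kx; have [_] := xmP i; exact.
have leu i x : K x -> y x i <= u i by move=> Kx; have [_] := xMP i; exact.
have m0 i : 0 <= m i.
  (* The [i]-th coordinate vanishes at any other vertex; there is one as [n > 0]. *)
  have [k ki] : exists k : 'I_n.+1, i != k.
    have [->|i0] := eqVneq i ord0; last by exists ord0.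
    by exists ord_max; rewrite -val_eqE/= eq_sym -lt0n.
  by have := mle i _ (Kp k); rewrite /y bary_vertex// (negbTE ki) oppr_le0.
have u0 i : 0 <= u i.
  by apply: le_trans (leu i _ (Kp i)); rewrite /y bary_vertex// ler0n.
have mP j : mu j j * m j <= \sum_(i | i != j) mu i j * u i.
  have [Kx _] := xmP j.
  have : 0 <= f j (xm j) by exact: G0.
  rewrite fy (bigD1 j)//= addrC -[y _ j]opprK -/(m j) mulNr subr_ge0 mulrC.
  move=> /le_trans; apply; apply: ler_sum => i _.
  by rewrite mulrC ler_wpM2l// leu.
have uP j : mu j j * u j <= mu j j + \sum_(i | i != j) mu i j * m i.
  have [Kx _] := xMP j.
  have := pM j _ Kx; rewrite fy (bigD1 j)//= -/(u j) mulrC -/(mu j j).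
  have : - \sum_(i | i != j) mu i j * m i <= \sum_(i | i != j) y (xM j) i * mu i j.
    rewrite -sumrN; apply: ler_sum => i _.
    by rewrite -mulrN mulrC ler_wpM2r// mle.
  by lra.
have sm := stochastic_sum_bound mu0 mu1 g0 gP m0 u0 mP uP.
have Ky x : K x -> exists y : 'I_n.+1 -> R,
    [/\ \sum_i y i = 1, x = \sum_i y i *: p i & forall i, - m i <= y i].
  move=> Kx; exists (y x); have [y1 yx] := baryP x ip.
  by split => // i; exact: mle.
apply: (@le_trans _ _ (1 + \sum_i m i)).
  apply: ge_inf; first by exists 0 => r [].
  exact: inscribed_simplex_ratio Ky.
by rewrite -addrA lerD2l (le_trans sm).
Qed.

Lemma avoidance_of_lt_asymmetry (R : realType) (n : nat) (K : set 'cV[R]_n)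
    (rho : R) :
  0 < rho -> rho < minkowski_asymmetry K ->
  forall e, exists2 x, K x & forall k, K k -> e <> x + rho *: k.
Proof.
move=> r0 rs e; apply: contrapT => H; move: rs; rewrite ltNge; apply/negP.
rewrite negbK; apply: ge_inf; first by exists 0 => r [].
split; first exact: ltW.
have [c ec] : exists c, e = c + rho *: c.
  exists ((1 + rho)^-1 *: e); rewrite -{1}[_ *: e]scale1r -scalerDl scalerA.
  by rewrite divff ?scale1r// gt_eqF// addr_gt0.
exists c => _ [x Kx <-].
have [k [Kk ek]] : exists k, K k /\ e = x + rho *: k.
  apply: contrapT => nk; apply: H; exists x => // k Kk ek; apply: nk.
  by exists k.
exists k => //; rewrite scalerBr; apply/eqP.
by rewrite subr_eq addrAC -ek ec addrC addKr.
Qed.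

(** The certificate requires a strict inequality on the asymmetry, so it is
    applied to every [d > eps], and [d] then tends to [eps]. *)
Lemma banach_mazur_le (R : realType) (n : nat) (K S : set 'cV[R]_n) (eps : R) :
  (0 < n)%N -> convex_body K -> 0 < eps < 1 ->
  n%:R - eps <= minkowski_asymmetry K -> simplex S ->
  banach_mazur K S <= 1 + eps + eps ^+ 2 / (2 * (1 - eps)).
Proof.
move=> n0 [cK vK [c Kc]] /andP[e0 e1] es sS.
have K0 : K !=set0 by exists c; exact: interior_subset.
pose phi (e : R) := 1 + e + e ^+ 2 / (2 * (1 - e)).
suff phic : phi e @[e --> eps^'+] --> phi eps.
  apply: (cvgr_to_ge phic); near=> d.
  have ed : eps < d by near: d; exact: nbhs_right_gt.
  have d1 : d < 1 by near: d; exact: nbhs_right_lt.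
  have n1 : 1 <= n%:R :> R by rewrite ler1n.
  apply: banach_mazur_le_of_certificate => //.
  apply: certificate_size => //; first by lra.
  by apply: avoidance_of_lt_asymmetry; lra.
apply: cvg_at_right_filter; apply: cvgD.
  by apply: cvgD; [exact: cvg_cst|exact: cvg_id].
apply: cvgM; first by apply: cvgM; exact: cvg_id.
apply: cvgV; first by rewrite mulf_neq0//; lra.
apply: cvgM; first exact: cvg_cst.
by apply: cvgB; [exact: cvg_cst|exact: cvg_id].
Unshelve. all: by end_near. Qed.

Lemma ratio_bound_series (R : realType) (eps : R) :
  0 < eps < 1 ->
  (1 + eps + \sum_(2 <= k < m) eps ^+ k / 2) @[m --> \oo]
    --> 1 + eps + eps ^+ 2 / (2 * (1 - eps)).
Proof.
move=> /andP[e0 e1]; apply: cvgD; first exact: cvg_cst.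
rewrite -(cvg_shiftn 2).
rewrite (_ : _ / _ = eps ^+ 2 / 2 / (1 - eps)); last by field; lra.
rewrite (_ : [sequence _]_n = series (geometric (eps ^+ 2 / 2) eps)).
  by apply: cvg_geometric_series; rewrite ger0_norm ?ltW.
apply/funext => m; rewrite /series /= -[2%N in LHS]add0n big_addn addnK.
by apply: eq_bigr => k _; rewrite exprD; ring.
Qed.

(** * The frustum *)

Lemma trmx_continuous (R : realType) (m n : nat) :
  continuous (trmx : 'M[R]_(m, n) -> 'M[R]_(n, m)).
Proof.
move=> M s /nbhs_ballP[e /= e0 es]; apply/nbhs_ballP; exists e => //= N [_ MN].
by apply: es; split => // i j; rewrite !mxE; exact: MN.
Qed.

Lemma cube_compact (R : realType) (n : nat) :
  compact [set x : 'cV[R]_n | forall i, 0 <= x i 0 <= 1].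
Proof.
rewrite (_ : mkset _ = trmx @` [set v : 'rV[R]_n | forall i, `[0, 1]%classic (v 0 i)]).
  apply: continuous_compact; first exact/continuous_subspaceT/trmx_continuous.
  by apply: (@rV_compact R n (fun=> `[0, 1]%classic)) => _; exact: segment_compact.
apply/seteqP; split=> [x x01|_ [v v01 <-] i].
  by exists x^T; rewrite ?trmxK// => i; rewrite /= in_itv/= mxE x01.
by have := v01 i; rewrite /= in_itv/= mxE.
Qed.

(** The coefficients of the slanted facet.  For [eps = 0] the frustum is a
    simplex, for [eps = 1] it is a prism over a simplex. *)
Definition frustum_weight (R : realType) (n : nat) (eps : R) (i : 'I_n.+1) : R :=
  if i == ord0 then 1 - eps else 1.

Definition frustum (R : realType) (n : nat) (eps : R) : set 'cV[R]_n.+1 :=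
  [set x | [/\ forall i, 0 <= x i 0, x ord0 0 <= 1 &
               \sum_i frustum_weight eps i * x i 0 <= 1]].

Lemma sum_frustum_weight (R : realType) (n : nat) (eps : R) :
  \sum_(i < n.+1) frustum_weight eps i = n.+1%:R - eps.
Proof.
rewrite big_ord_recl/= (eq_bigr (fun=> 1)) => [|i _]//.
rewrite sumr_const card_ord /frustum_weight eqxx -(natr1 n); ring.
Qed.

Lemma frustum_weight_ge0 (R : realType) (n : nat) (eps : R) (i : 'I_n.+1) :
  eps <= 1 -> 0 <= frustum_weight eps i.
Proof. by move=> e1; rewrite /frustum_weight; case: ifP => _; rewrite ?subr_ge0. Qed.

Lemma frustum_le1 (R : realType) (n : nat) (eps : R) (x : 'cV[R]_n.+1) (i : 'I_n.+1) :
  eps <= 1 -> frustum eps x -> x i 0 <= 1.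
Proof.
move=> e1 [x0 x01 xs]; have [->//|i0] := eqVneq i ord0.
apply: le_trans xs; rewrite (bigD1 i)//= {1}/frustum_weight (negbTE i0) mul1r lerDl.
by apply: sumr_ge0 => j _; rewrite mulr_ge0 ?frustum_weight_ge0.
Qed.

Lemma frustum_sum_continuous (R : realType) (n : nat) (eps : R) :
  continuous (fun x : 'cV[R]_n.+1 => \sum_i frustum_weight eps i * x i 0).
Proof.
apply: (continuous_sum (f := fun i (x : 'cV[R]_n.+1) => frustum_weight eps i * x i 0)).
by move=> i x; apply: continuousM; [exact: cst_continuous|exact: coord_continuous].
Qed.

Lemma frustum_convex_body (R : realType) (n : nat) (eps : R) :
  0 <= eps <= 1 -> convex_body (frustum eps : set 'cV[R]_n.+1).
Proof.
move=> /andP[e0 e1]; split.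
- apply: (subclosed_compact _ (@cube_compact R n.+1)); last first.
    by move=> x Kx i; rewrite (frustum_le1 i e1 Kx) andbT; case: Kx.
  rewrite (_ : frustum eps = (\bigcap_(i : 'I_n.+1) [set x : 'cV[R]_n.+1 | 0 <= x i 0])
    `&` ([set x | x ord0 0 <= 1] `&` [set x | \sum_i frustum_weight eps i * x i 0 <= 1])).
    apply: closedI; last apply: closedI.
    + apply: closed_bigI => i _.
      apply: (preimage_closed (f := fun x : 'cV[R]_n.+1 => x i 0)) (@closed_ge R 0).
      by move=> x _; exact: coord_continuous.
    + apply: (preimage_closed (f := fun x : 'cV[R]_n.+1 => x ord0 0)) (@closed_le R 1).
      by move=> x _; exact: coord_continuous.
    + apply: preimage_closed (@closed_le R 1).
      by move=> x _; exact: frustum_sum_continuous.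
  apply/seteqP; split=> x; first by case=> x0 x1 xs; split=> // i _; exact: x0.
  by case=> x0 [x1 xs]; split=> // i; exact: (x0 i).
- apply/convex_setP => x y t [x0 x1 xs] [y0 y1 ys] /andP[t0 t1].
  have t1' : 0 <= 1 - t by rewrite subr_ge0.
  have conv1 (a b : R) : a <= 1 -> b <= 1 -> t * a + (1 - t) * b <= 1 by nra.
  split=> [i||].
  + by rewrite !mxE addr_ge0// mulr_ge0.
  + by rewrite !mxE conv1.
  + rewrite (eq_bigr (fun i => t * (frustum_weight eps i * x i 0) +
      (1 - t) * (frustum_weight eps i * y i 0))) => [|i _]; last by rewrite !mxE; ring.
    by rewrite big_split/= -!mulr_sumr conv1.
- pose a : R := n.+2%:R^-1.
  have n2 : 1 < n.+2%:R :> R by rewrite ltr1n.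
  have a0 : 0 < a by rewrite invr_gt0 (lt_trans ltr01).
  have a1 : a < 1 by rewrite invf_lt1 ?(lt_trans ltr01).
  exists (const_mx a).
  have I1 : \forall x \near (const_mx a : 'cV[R]_n.+1),
      forall i, 0 < (x : 'cV[R]_n.+1) i 0.
    apply: (filter_forall (f := fun i => [set x : 'cV[R]_n.+1 | 0 < x i 0])
      (nbhs_filter (const_mx a : 'cV[R]_n.+1))) => i.
    apply: (cvgr_gt _ (@coord_continuous R n.+1 1 i 0 (const_mx a))).
    by rewrite mxE.
  have I2 : \forall x \near (const_mx a : 'cV[R]_n.+1), (x : 'cV[R]_n.+1) ord0 0 < 1.
    apply: (cvgr_lt _ (@coord_continuous R n.+1 1 ord0 0 (const_mx a))).
    by rewrite mxE.
  have I3 : \forall x \near (const_mx a : 'cV[R]_n.+1),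
      \sum_i frustum_weight eps i * (x : 'cV[R]_n.+1) i 0 < 1.
    apply: (cvgr_lt _ (@frustum_sum_continuous R n eps (const_mx a))).
    under eq_bigr do rewrite mxE.
    rewrite -mulr_suml sum_frustum_weight ltr_pdivrMr ?(lt_trans ltr01)// mul1r.
    by rewrite -(natr1 n.+1); lra.
  rewrite /interior; near=> x; split.
  + by move=> i; apply: ltW; move: i; near: x.
  + by apply: ltW; near: x.
  + by apply: ltW; near: x.
Unshelve. all: by end_near. Qed.

Lemma delta_colE (R : realType) (n : nat) (i j : 'I_n) :
  (delta_mx i 0 : 'cV[R]_n) j 0 = (j == i)%:R.
Proof. by rewrite mxE eqxx andbT. Qed.

Lemma frustum_sum_delta (R : realType) (n : nat) (eps : R) (i : 'I_n.+1) :
  \sum_j frustum_weight eps j * (delta_mx i 0 : 'cV[R]_n.+1) j 0 = frustum_weight eps i.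
Proof.
rewrite (bigD1 i)//= delta_colE eqxx mulr1 big1 ?addr0// => j /negbTE ji.
by rewrite delta_colE ji mulr0.
Qed.

Lemma frustum0 (R : realType) (n : nat) (eps : R) : frustum eps (0 : 'cV[R]_n.+1).
Proof.
split=> [i||]; rewrite ?mxE//; under eq_bigr do rewrite mxE mulr0.
by rewrite big1.
Qed.

Lemma frustum_delta (R : realType) (n : nat) (eps : R) (i : 'I_n.+1) :
  0 <= eps -> frustum eps (delta_mx i 0 : 'cV[R]_n.+1).
Proof.
move=> e0; split=> [j||]; rewrite ?delta_colE ?ler0n ?lern1 ?leq_b1//.
by rewrite frustum_sum_delta /frustum_weight; case: ifP => _; lra.
Qed.

(** The centre with all coordinates [1 / (1 + s)] realises [s = n - eps], where
    [s >= 1] is what keeps the reflected body below height 1.  Conversely, the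
    vertices [e_i] and [0] force [(1 + rho) c_i >= 1] and
    [(1 + rho) (1 - sum w_i c_i) >= 1] for any centre [c], [w] being the facet
    weights, whose sum is [n - eps]. *)
Lemma frustum_asymmetry (R : realType) (n : nat) (eps : R) :
  0 <= eps <= 1 -> (0 < n)%N ->
  minkowski_asymmetry (frustum eps : set 'cV[R]_n.+1) = n.+1%:R - eps.
Proof.
move=> /andP[e0 e1] n0; set s := n.+1%:R - eps.
have n1 : 1 <= n%:R :> R by rewrite ler1n.
have s1 : 1 <= s by rewrite /s -natr1; lra.
have s0 : s != 0 by rewrite gt_eqF// (lt_le_trans ltr01).
rewrite /minkowski_asymmetry; set B := mkset _.
have Bs : B s.
  split; first exact: le_trans s1.
  exists (const_mx (1 + s)^-1) => _ [x Kx <-].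
  (* The point [k] with [x - c = s (c - k)]. *)
  exists (s^-1 *: (const_mx 1 - x)).
    have x1 i := frustum_le1 i e1 Kx; have [x0 _ xs] := Kx; split.
    + by move=> i; rewrite !mxE mulr_ge0 ?subr_ge0// invr_ge0 (le_trans ler01).
    + rewrite !mxE -[leRHS](mulVf s0) ler_pM2l ?invr_gt0 ?(lt_le_trans ltr01)//.
      by rewrite (le_trans _ s1)// gerBl.
    + rewrite (eq_bigr (fun i => s^-1 * (frustum_weight eps i -
        frustum_weight eps i * x i 0))) => [|i _]; last by rewrite !mxE; ring.
      rewrite -mulr_sumr sumrB sum_frustum_weight -/s.
      rewrite -[leRHS](mulVf s0) ler_pM2l ?invr_gt0 ?(lt_le_trans ltr01)//.
      rewrite gerBl; apply: sumr_ge0 => i _.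
      by rewrite mulr_ge0 ?frustum_weight_ge0.
  apply/colP => i; rewrite !mxE; field.
  by rewrite s0 gt_eqF// addr_gt0// (lt_le_trans ltr01).
apply/eqP; rewrite eq_le; apply/andP; split.
  by apply: ge_inf => //; exists 0 => r [].
apply: lb_le_inf; first by exists s.
move=> rho [r0 [c Kc]].
have refl x : frustum eps x -> exists2 k, frustum eps k & (1 + rho) *: c = x + rho *: k.
  move=> Kx; have [|k Kk kE] := Kc (x - c); first by exists x.
  exists k => //; rewrite scalerDl scale1r.
  rewrite -[rho *: c](subrK (rho *: k)) -scalerBr kE addrA; congr (_ + _).
  by rewrite addrC subrK.
have ci i : 1 <= (1 + rho) * c i 0.
  have [k [k0 _ _]] := refl _ (frustum_delta i e0).
  move=> /colP/(_ i); rewrite !mxE !eqxx => ->.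
  by rewrite lerDl mulr_ge0.
have [k [_ _ ks]] := refl _ (frustum0 _ _); rewrite add0r => ck.
have : \sum_(i < n.+1) frustum_weight eps i <= rho.
  apply: (@le_trans _ _ (\sum_i frustum_weight eps i * ((1 + rho) * c i 0))).
    apply: ler_sum => i _; rewrite -[leLHS]mulr1 ler_wpM2l//.
    exact: frustum_weight_ge0.
  rewrite (eq_bigr (fun i => rho * (frustum_weight eps i * k i 0))) => [|i _].
    by rewrite -mulr_sumr -[leRHS]mulr1 ler_wpM2l.
  by move: ck => /colP/(_ i); rewrite !mxE => ->; ring.
by rewrite sum_frustum_weight.
Qed.

(** The base of the frustum together with the vertex [e_0] of its top; index 0
    is the top vertex, and index [j + 1] is the base vertex [e_j], except that
    [j = 0] stands for the origin, since [e_0] is not in the base. *)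
Definition frustum_simplex (R : realType) (n : nat) (i : 'I_n.+2) : 'cV[R]_n.+1 :=
  if unlift ord0 i is Some j then (if j == ord0 then 0 else delta_mx j 0)
  else delta_mx ord0 0.

Lemma frustum_simplex_comb (R : realType) (n : nat) (a : 'I_n.+2 -> R) (j : 'I_n.+1) :
  (\sum_i a i *: frustum_simplex R i) j 0 =
  if j == ord0 then a ord0 else a (lift ord0 j).
Proof.
rewrite summxE big_ord_recl mxE {1}/frustum_simplex unlift_none delta_colE.
rewrite (eq_bigr (fun l => a (lift ord0 l) * ((l != ord0) && (j == l))%:R)); last first.
  move=> l _; rewrite mxE /frustum_simplex liftK; have [_|_] := eqVneq l ord0.
    by rewrite mxE.
  by rewrite delta_colE.
rewrite (bigD1 j)//= eqxx andbT big1 => [|l lj]; last first.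
  by rewrite [j == l]eq_sym (negbTE lj) andbF mulr0.
by case: eqP => _ /=; rewrite ?mulr0 ?mulr1 ?addr0 ?add0r.
Qed.

Lemma frustum_simplex_indep (R : realType) (n : nat) :
  affinely_independent (@frustum_simplex R n).
Proof.
move=> a a0 ap.
have a_0 : a ord0 = 0.
  by have := frustum_simplex_comb a ord0; rewrite ap mxE eqxx.
have a_S j : j != ord0 -> a (lift ord0 j) = 0.
  by move=> /negbTE j0; have := frustum_simplex_comb a j; rewrite ap mxE j0.
move: a0; rewrite big_ord_recl a_0 add0r (bigD1 ord0)//= big1 => [|j]; last exact: a_S.
rewrite addr0 => a_1 i; case: (unliftP ord0 i) => [j ->|->//].
by have [->|/a_S] := eqVneq j ord0.
Qed.

(** Let [c], [d], [C], [D] be the barycentric coordinates of the corners [0],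
    [e_1], [e_0], [e_0 + eps e_1] in the surrounding simplex, whose vertices are
    [v + rho z k] with [z k] in [K].  The two parallel sides of the trapezoid give
    [D - C = eps (d - c)].  With [t = 1 - sum min(c, d)], the lower side gives
    [1 <= rho t], because [K] has width at most 1.  As [K] has height at most 1
    and all four coordinate vectors are nonnegative, the side from [0] to [e_0]
    gives [1 <= rho (1 - eps t)].  Adding [eps] times the former inequality to
    the latter yields the claim. *)
Lemma banach_mazur_frustum_ge (R : realType) (n : nat) (K S : set 'cV[R]_n.+2)
    (eps rho : R) (A : 'M[R]_n.+2) (u v : 'cV[R]_n.+2) :
  let e i := delta_mx i 0 : 'cV[R]_n.+2 in
  0 <= eps <= 1 -> (forall x, K x -> 0 <= x ord0 0 <= 1 /\ 0 <= x ord_max 0 <= 1) ->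
  K 0 -> K (e ord0) -> K (e ord_max) -> K (e ord0 + eps *: e ord_max) ->
  simplex S -> 0 <= rho -> A \in unitmx ->
  [set u + x | x in K] `<=` [set A *m y | y in S] ->
  [set A *m y | y in S] `<=` [set v + rho *: x | x in K] ->
  1 + eps <= rho.
Proof.
move=> e /andP[eps0 eps1] K01 K0 Ke0 Ke1 Kt [q iq ->] r0 uA KS SK.
rewrite convex_hull_range in KS SK.
have /choice[z zP] : forall k, exists z, K z /\ v + rho *: z = A *m q k.
  move=> k; have [|z Kz zE] := SK (A *m q k); last by exists z.
  exists (q k) => //; exists (fun l => (l == k)%:R); split=> [l||].
  - exact: ler0n.
  - by rewrite (bigD1 k)//= eqxx big1 ?addr0// => l /negbTE ->.
  - rewrite (bigD1 k)//= eqxx scale1r big1 ?addr0// => l /negbTE ->.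
    by rewrite scale0r.
have z01 k : 0 <= z k ord0 0 <= 1 /\ 0 <= z k ord_max 0 <= 1.
  by have [/K01] := zP k.
have rep x : K x -> exists c : 'I_n.+3 -> R, [/\ forall k, 0 <= c k, \sum_k c k = 1,
    u + x = A *m (\sum_k c k *: q k) & u + x = v + rho *: \sum_k c k *: z k].
  move=> Kx; have [|y [c [c0 c1 yE]] yx] := KS (u + x); first by exists x.
  exists c; split => //; first by rewrite -yE.
  rewrite -yx yE mulmx_sumr -[v in RHS]scale1r -c1 scaler_suml scaler_sumr -big_split/=.
  apply: eq_bigr => k _; rewrite -scalemxAr -(zP k).2 scalerDr !scalerA.
  by rewrite (mulrC rho).
have [c [c0 c1 cq cz]] := rep _ K0.
have [d [d0 d1 dq dz]] := rep _ Ke1.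
have [C [C0 C1 Cq Cz]] := rep _ Ke0.
have [D [D0 D1 Dq Dz]] := rep _ Kt.
have CD k : D k - C k = eps * (d k - c k).
  apply/eqP; rewrite -subr_eq0; apply/eqP.
  apply: (iq (fun k => (D k - C k) - eps * (d k - c k))).
    by rewrite !(sumrB, =^~ mulr_sumr) c1 d1 C1 D1 !subrr mulr0 subr0.
  have lin : \sum_k ((D k - C k) - eps * (d k - c k)) *: q k =
     (\sum_k D k *: q k - \sum_k C k *: q k)
     - eps *: (\sum_k d k *: q k - \sum_k c k *: q k).
    rewrite -!sumrB scaler_sumr -sumrB; apply: eq_bigr => l _.
    by rewrite !scalerBl -scalerA scalerBl.
  apply: (can_inj (mulKmx uA)); rewrite lin mulmxBr -scalemxAr !mulmxBr -cq -dq -Cq -Dq.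
  rewrite mulmx0 addr0 [u + _ - u]addrAC subrr add0r addrA.
  by rewrite [_ + _ - (u + _)]addrAC subrr add0r subrr.
have coord x c' j : u + x = v + rho *: \sum_k c' k *: z k ->
    u j 0 + x j 0 = v j 0 + rho * \sum_k c' k * z k j 0.
  move=> /colP/(_ j); rewrite !mxE summxE => ->; congr (_ + _ * _).
  by apply: eq_bigr => k _; rewrite mxE.
have cz1 := coord _ _ ord_max cz; have dz1 := coord _ _ ord_max dz.
have cz0 := coord _ _ ord0 cz; have Cz0 := coord _ _ ord0 Cz.
rewrite !mxE !eqxx /= in cz1 dz1 cz0 Cz0.
pose mn k := Num.min (c k) (d k).
have mc k : mn k <= c k by rewrite ge_min lexx.
have md k : mn k <= d k by rewrite ge_min lexx orbT.
have width : 1 <= rho * (1 - \sum_k mn k).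
  have : \sum_k (d k * z k ord_max 0 - c k * z k ord_max 0) <= \sum_k (d k - mn k).
    apply: ler_sum => k _; have [_ /andP[z0 z1]] := z01 k.
    by have := mc k; have := md k; nra.
  by rewrite !sumrB d1 => /(ler_wpM2l r0); lra.
have height : 1 <= rho * (1 - eps + eps * \sum_k mn k).
  have : \sum_k (C k * z k ord0 0 - c k * z k ord0 0) <=
      \sum_k (C k - eps * c k + eps * mn k).
    apply: ler_sum => k _; have [/andP[z0 z1] _] := z01 k.
    have z1' : 0 <= 1 - z k ord0 0 by rewrite subr_ge0.
    rewrite /mn; case: (leP (c k) (d k)) => cd.
      have := mulr_ge0 (C0 k) z1'; have := mulr_ge0 (c0 k) z0; lra.
    (* Here [min (c k) (d k) = d k], and the right-hand side is [D k]. *)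
    have cd0 : 0 <= (1 - eps) * c k + eps * d k.
      by rewrite addr_ge0// mulr_ge0// subr_ge0.
    have -> : C k = D k - eps * (d k - c k) by rewrite -CD subKr.
    have := mulr_ge0 (D0 k) z1'; have := mulr_ge0 cd0 z0; lra.
  rewrite !(big_split, sumrN)/= -!mulr_sumr C1 c1 mulr1.
  by move=> /(ler_wpM2l r0); lra.
by have := ler_wpM2l eps0 width; lra.
Qed.

Lemma banach_mazur_frustum (R : realType) (n : nat) (S : set 'cV[R]_n.+2) (eps : R) :
  0 <= eps <= 1 -> simplex S ->
  banach_mazur (frustum eps) S = 1 + eps.
Proof.
move=> eps01 sS; have /andP[e0 e1] := eps01.
have [_ vK _] := frustum_convex_body n.+1 eps01.
(* The index of the origin, the only vertex whose coordinate can be negative: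
   at [e_0 + eps e_j] it equals [- eps]. *)
pose b : 'I_n.+3 := lift ord0 ord0.
pose m (i : 'I_n.+3) : R := if i == b then eps else 0.
have Kp i : frustum eps (frustum_simplex R i : 'cV[R]_n.+2).
  rewrite /frustum_simplex; case: unlift => [j|]; last exact: frustum_delta.
  by case: ifP => _; [exact: frustum0|exact: frustum_delta].
have m0 i : 0 <= m i by rewrite /m; case: ifP.
have Ky x : frustum eps x -> exists y : 'I_n.+3 -> R,
    [/\ \sum_i y i = 1, x = \sum_i y i *: frustum_simplex R i & forall i, - m i <= y i].
  move=> Kx; have [x0 x1 xs] := Kx.
  pose y (i : 'I_n.+3) := if unlift ord0 i is Some j then
    (if j == ord0 then 1 - \sum_k x k 0 else x j 0) else x ord0 0.
  have yb : y b = 1 - \sum_k x k 0 by rewrite /y /b liftK eqxx.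
  have y0 : y ord0 = x ord0 0 by rewrite /y unlift_none.
  have yS j : j != ord0 -> y (lift ord0 j) = x j 0.
    by move=> /negbTE j0; rewrite /y liftK j0.
  exists y; split.
  - rewrite big_ord_recl y0 (bigD1 ord0)//= (eq_bigr (fun j => x j 0)) => [|j /yS//].
    by rewrite -/b yb [\sum_k x k 0](bigD1 ord0)//=; ring.
  - apply/colP => j; rewrite frustum_simplex_comb.
    by have [->|/yS] := eqVneq j ord0.
  - move=> i; rewrite /m; have [->|ib] := eqVneq i b.
      rewrite yb; have -> : \sum_k x k 0 = \sum_k frustum_weight eps k * x k 0 + eps * x ord0 0.
        rewrite (bigD1 ord0)//= [in RHS](bigD1 ord0)//= {1}/frustum_weight eqxx.
        rewrite [in RHS](eq_bigr (fun j => x j 0)) => [|j /negbTE j0]; first by ring.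
        by rewrite /frustum_weight j0 mul1r.
      by have := mulr_ge0 e0 (x0 ord0); have := ler_wpM2l e0 x1; lra.
    rewrite oppr0; case: (unliftP ord0 i) ib => [j ->|-> _]; last by rewrite y0.
    by rewrite (inj_eq lift_inj) => /yS ->.
have sm : \sum_i m i = eps.
  by rewrite (bigD1 b)//= /m eqxx big1 ?addr0// => i /negbTE ->.
have := inscribed_simplex_ratio vK sS (@frustum_simplex_indep R n.+1) Kp m0 Ky.
rewrite sm /banach_mazur; set B := mkset _ => Be.
apply/eqP; rewrite eq_le; apply/andP; split.
  by apply: ge_inf => //; exists 0 => r [].
apply: lb_le_inf; first by exists (1 + eps).
move=> rho [r0 [A [u [v [uA KS SK]]]]].
apply: banach_mazur_frustum_ge KS SK => //.
- move=> x Kx; have x1 i := frustum_le1 i e1 Kx.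
  by have [x0 _ _] := Kx; rewrite !x0 !x1.
- exact: frustum0.
- exact: frustum_delta.
- exact: frustum_delta.
- split=> [i||].
  + by rewrite !mxE addr_ge0 ?ler0n// mulr_ge0.
  + by rewrite !mxE/= mulr0 addr0.
  + rewrite (eq_bigr (fun i =>
        frustum_weight eps i * (delta_mx ord0 0 : 'cV[R]_n.+2) i 0 +
        eps * (frustum_weight eps i * (delta_mx ord_max 0 : 'cV[R]_n.+2) i 0)))
      => [|i _]; last by rewrite !mxE; ring.
    rewrite big_split/= -mulr_sumr !frustum_sum_delta /frustum_weight eqxx/=.
    by rewrite mulr1 subrK.
Qed.

Theorem theorem1p1 (R : realType) :
  (forall (n : nat) (K : set 'cV[R]_n) (eps : R),
     (0 < n)%N -> convex_body K -> 0 < eps < 1 ->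
     n%:R - eps <= minkowski_asymmetry K ->
     (forall S : set 'cV[R]_n, simplex S ->
        banach_mazur K S <= 1 + eps + eps ^+ 2 / (2 * (1 - eps))) /\
     (1 + eps + \sum_(2 <= k < m) eps ^+ k / 2) @[m --> \oo]
       --> 1 + eps + eps ^+ 2 / (2 * (1 - eps))) /\
  (forall (n : nat) (eps : R), (2 <= n)%N -> 0 <= eps <= 1 ->
     exists K : set 'cV[R]_n,
       [/\ convex_body K,
           minkowski_asymmetry K = n%:R - eps &
           forall S : set 'cV[R]_n, simplex S -> banach_mazur K S = 1 + eps]).
Proof.
split=> [n K eps n0 bK eps01 es|[|[|n]]// eps _ eps01].
  by split=> [S|]; [exact: banach_mazur_le|exact: ratio_bound_series].
exists (frustum eps); split; first exact: frustum_convex_body.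
- exact: frustum_asymmetry.
- by move=> S; exact: banach_mazur_frustum.
Qed.
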